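(* For every knotoid $k$, $h_+(k) \geq \deg^+(F_k)$ and $h_-(k) \geq \deg^-(F_k)$, where $F_k$ is the index polynomial of $k$.
   Context: A knotoid diagram $K$ is an immersion of a closed interval into the oriented sphere $S^2$ whose only singularities are transverse double crossings (the endpoints are not crossing points), together with over/under information at each crossing; it is oriented from its tail $v_0$ to its head $v_1$. A knotoid is a class of knotoid diagrams up to isotopy of $S^2$ and the Reidemeister moves I, II, III performed away from the endpoints (no strand may be moved over or under an endpoint). A shortcut for $K$ is an embedded path $a$ in $S^2$ from $v_0$ to $v_1$ that intersects $K$ transversely and does not pass through crossings of $K$. The common endpoints $v_0,v_1$ are not counted as intersections. Orienting $a$ from $v_0$ to $v_1$, an intersection of an oriented strand with $a$ is positive ($+$) if the strand crosses $a$ from the right of $a$ to the left of $a$, and negative ($-$) otherwise. A pair $(K,a)$ is a shortcut diagram, representing the knotoid represented by $K$; $h_\pm(K,a)$ is the number of positive/negative intersections of $K$ with $a$. The signed heights $h_+(k)$ and $h_-(k)$ of a knotoid $k$ are the minima of $h_+(K,a)$ and of $h_-(K,a)$, respectively, each taken separately over all shortcut diagrams representing $k$. For a crossing $c$ of $K$, the unique orientation-respecting smoothing of $c$ yields an interval with the same endpoints as $K$ and a loop $L$ (the segment of $K$ from $c$ to $c$). The intersection index $\mathrm{Ind}(c)\in\mathbb Z$ is the winding number of $L$ around the twice-punctured sphere $S^2-\{v_0,v_1\}$, i.e. the algebraic intersection number of $L$ with any shortcut for $K$, with the sign convention above. For $n\neq 0$, the $n$-writhe $J_n(K)$ is half the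 sum of the (usual) signs of the crossings of $K$ of index $n$; it is known to be an integer and an invariant $J_n(k)$ of the knotoid $k$. The index polynomial of $k$ is $$F_k(t)=\sum_{n\ne 0}J_n(k)(t^n-1)\in\mathbb Z[t,t^{-1}].$$ For a nonzero Laurent polynomial $p(t)$ with largest exponent $\mathrm{maxdeg}(p)$ and smallest exponent $\mathrm{mindeg}(p)$, put $\deg^+(p)=\max\{\mathrm{maxdeg}(p),0\}$ and $\deg^-(p)=\max\{-\mathrm{mindeg}(p),0\}$; also $\deg^\pm(0)=0$. *)

(* Defs.v *)
(* Mathematical Components, with classical choice from mathcomp.classical.boolp. *)
From HB Require Import structures.
From Stdlib Require Import Relation_Operators.
From mathcomp Require Import all_boot all_order all_algebra.
From mathcomp Require Import generic_quotient finmap monalg boolp.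

Set Implicit Arguments.
Unset Strict Implicit.
Unset Printing Implicit Defensive.

Import Order.TTheory GRing.Theory Num.Theory.
Local Open Scope ring_scope.

(* Generic curves on the oriented sphere are encoded, up to isotopy of the     *)
(* sphere, by their Gauss words: the list of crossings met along the curve,    *)
(* with the local orientation at each of them.  Such a word determines a       *)
(* rotation system, hence a cell decomposition of a closed oriented surface;   *)
(* the words that come from curves on the sphere are those for which this      *)
(* surface has Euler characteristic 2.  The unions of curves considered here   *)
(* are connected, so all complementary regions on the sphere are discs and the *)
(* encoding loses no information.                                              *)

Section PlaneCurves.

(* [S] lists the words of curves running from a common tail v0 to a common     *)
(* head v1 (at most two curves; for more, the cyclic orders at v0 and v1 would *)
(* not be determined by the list).  A visit (x, true) means that the curve     *)
(* passes through the double point x from the right to the left of the other   *)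
(* branch at x, and (x, false) that it passes from the left to the right.      *)
Variable L : eqType.
Implicit Type S : seq (seq (L * bool)).

Definition strand S (s : nat) : seq (L * bool) := nth [::] S s.

Definition positions S : seq (nat * nat) :=
  [seq (s, i) | s <- iota 0 (size S), i <- iota 0 (size (strand S s))].

Definition point_at S (p : nat * nat) : option L :=
  omap fst (onth (strand S p.1) p.2).

Definition other_position S (p : nat * nat) : nat * nat :=
  head p [seq q <- positions S | (q != p) && (point_at S q == point_at S p)].

(* The edge i of a strand w ends at its visit number i, or at v1 if i = size w; *)
(* it starts at visit number i - 1, or at v0 if i = 0.  The dart (s, i, true)   *)
(* is the edge i of strand s directed along s; (s, i, false) is its reverse.    *)
Definition dart := (nat * nat * bool)%type.

Definition darts S : seq dart :=
  [seq (si, b) | si <- [seq (s, i) | s <- iota 0 (size S),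
                                     i <- iota 0 (size (strand S s)).+1],
                 b <- [:: true; false]].

(* The dart that follows [d] on the boundary of the region to the left of [d]. *)
Definition next_dart S (d : dart) : dart :=
  let: (s, i, forward) := d in
  let w := strand S s in
  let s' := (s.+1 %% size S)%N in
  let turn (j : nat) (side : bool) :=
    let q := other_position S (s, j) in
    if side then (q.1, q.2.+1, true) else (q.1, q.2, false) in
  let leftward (j : nat) := nth false (map snd w) j in
  if forward then
    if i == size w then (s', size (strand S s'), false)
    else turn i (~~ leftward i)
  else
    if i == 0%N then (s', 0%N, true) else turn i.-1 (leftward i.-1).

Definition num_vertices S : nat := (size (undup (map fst (flatten S)))).+2.

Definition num_edges S : nat := (\sum_(w <- S) (size w).+1)%N.

Definition num_faces S : nat :=
  n_comp [rel d d' : seq_sub (darts S) | next_dart S (val d) == val d'] predT.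

Definition spherical S : bool :=
  (num_vertices S + num_faces S == num_edges S + 2)%N.

End PlaneCurves.

(* A passage (c, o, s) of a knotoid diagram through its crossing c: o tells    *)
(* whether it is the over-passage, s whether c is a positive crossing.         *)
Definition passage := (nat * bool * bool)%type.
Definition label (p : passage) : nat := p.1.1.
Definition is_over (p : passage) : bool := p.1.2.
Definition is_positive (p : passage) : bool := p.2.

Definition other_passage (p : passage) : passage :=
  (label p, ~~ is_over p, is_positive p).

Definition gauss_word (w : seq passage) : bool :=
  uniq [seq (label p, is_over p) | p <- w]
    && all (fun p => other_passage p \in w) w.

(* A crossing is positive when the under-strand passes from the right to the   *)
(* left of the over-strand.  The two injections into [nat + nat] keep apart    *)
(* the crossings of a diagram and its intersections with a shortcut.           *)
Definition flat_passage (p : passage) : (nat + nat) * bool :=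
  (inl (label p), is_over p (+) is_positive p).

Definition diagram_word (w : seq passage) : bool :=
  gauss_word w && spherical [:: map flat_passage w].

Record diagram := Diagram {
  word_of : seq passage;
  word_ofP : diagram_word word_of
}.

HB.instance Definition _ := [isSub for word_of].
HB.instance Definition _ := [Choice of diagram by <:].

(* Isotopy (renaming of crossings) and Reidemeister moves.  In each move the   *)
(* remaining parts u, v, ... of the word are arbitrary, possibly empty.        *)
Inductive reidemeister_word : seq passage -> seq passage -> Prop :=
| Renaming w (f : nat -> nat) :
    injective f ->
    reidemeister_word w [seq (f (label p), is_over p, is_positive p) | p <- w]
| ReidemeisterI u v c o s :
    reidemeister_word (u ++ v) (u ++ [:: (c, o, s); (c, ~~ o, s)] ++ v)
(* the two sides of the bigon are directed the same way *)
| ReidemeisterII_direct u v w c d o s :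
    reidemeister_word (u ++ v ++ w)
      (u ++ [:: (c, o, s); (d, o, ~~ s)]
         ++ v ++ [:: (c, ~~ o, s); (d, ~~ o, ~~ s)] ++ w)
(* the two sides of the bigon are directed opposite ways *)
| ReidemeisterII_opposite u v w c d o s :
    reidemeister_word (u ++ v ++ w)
      (u ++ [:: (c, o, s); (d, o, ~~ s)]
         ++ v ++ [:: (d, ~~ o, ~~ s); (c, ~~ o, s)] ++ w)
(* The top, middle and bottom strands of the triangle cross at x (top, middle), *)
(* y (top, bottom) and z (middle, bottom).  The boolean ccw tells whether x, y, *)
(* z are in counterclockwise order around the triangle, and dt, db, dm whether  *)
(* the strands are directed from x to y, from y to z, from z to x; the signs of *)
(* the crossings are then forced.  The move translates one strand across the    *)
(* crossing of the other two: it keeps ccw and exchanges the two crossings on   *)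
(* each strand.                                                                 *)
| ReidemeisterIII u0 u1 u2 u3 b1 b2 b3 x y z (ccw dt dm db : bool) :
    let sx := ~~ (ccw (+) dt (+) dm) in
    let sy := ccw (+) dt (+) db in
    let sz := ~~ (ccw (+) dm (+) db) in
    let directed (d : bool) (p q : passage) :=
      if d then [:: p; q] else [:: q; p] in
    let top := directed dt (x, true, sx) (y, true, sy) in
    let middle := directed dm (z, true, sz) (x, false, sx) in
    let bottom := directed db (y, false, sy) (z, false, sz) in
    perm_eq [:: b1; b2; b3] [:: top; middle; bottom] ->
    reidemeister_word
      (u0 ++ b1 ++ u1 ++ b2 ++ u2 ++ b3 ++ u3)
      (u0 ++ rev b1 ++ u1 ++ rev b2 ++ u2 ++ rev b3 ++ u3).

Definition reidemeister (K K' : diagram) : Prop :=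
  reidemeister_word (word_of K) (word_of K').

Definition knotoid_rel : rel diagram :=
  fun K K' => `[< clos_refl_sym_trans diagram reidemeister K K' >].

Lemma knotoid_rel_refl : reflexive knotoid_rel.
Proof. by move=> K; apply/asboolP; apply: rst_refl. Qed.

Lemma knotoid_rel_sym : symmetric knotoid_rel.
Proof. by move=> K K'; apply/asboolP/asboolP => ?; apply: rst_sym. Qed.

Lemma knotoid_rel_trans : transitive knotoid_rel.
Proof.
move=> K K' K'' /asboolP h1 /asboolP h2.
by apply/asboolP; apply: rst_trans h1 h2.
Qed.

Canonical knotoid_equiv :=
  EquivRel knotoid_rel knotoid_rel_refl knotoid_rel_sym knotoid_rel_trans.

Definition knotoid := {eq_quot knotoid_equiv}%qT.
HB.instance Definition _ := EqQuotient.on knotoid.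

Definition represents (K : diagram) (k : knotoid) : Prop := (\pi_knotoid K)%qT = k.

(* Intersections of a diagram with a shortcut: a name, and whether the strand  *)
(* of the diagram crosses the shortcut from its right to its left.             *)
Definition hit := (nat * bool)%type.
Definition letter := (passage + hit)%type.

Definition passages (w : seq letter) : seq passage :=
  pmap (fun x => if x is inl p then Some p else None) w.

Definition hits (w : seq letter) : seq hit :=
  pmap (fun x => if x is inr h then Some h else None) w.

Definition flat_letter (x : letter) : (nat + nat) * bool :=
  match x with inl p => flat_passage p | inr h => (inr h.1, h.2) end.

(* If K passes from the right to the left of the shortcut, then the shortcut   *)
(* passes from the left to the right of K.                                     *)
Definition flat_hit (h : hit) : (nat + nat) * bool := (inr h.1, ~~ h.2).

(* [w] lists the crossings and the intersections with the shortcut along K,    *)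
(* [a] lists the intersections along the shortcut.                             *)
Definition is_shortcut (K : diagram) (w : seq letter) (a : seq hit) : bool :=
  [&& passages w == word_of K,
      uniq (map fst (hits w)),
      perm_eq a (hits w)
    & spherical [:: map flat_letter w; map flat_hit a]].

Record shortcut_diagram := ShortcutDiagram {
  diagram_of : diagram;
  letters_of : seq letter;
  shortcut_of : seq hit;
  shortcut_ofP : is_shortcut diagram_of letters_of shortcut_of
}.

Definition diagram_h_plus (D : shortcut_diagram) : nat :=
  count (fun h : hit => h.2) (hits (letters_of D)).

Definition diagram_h_minus (D : shortcut_diagram) : nat :=
  count (fun h : hit => ~~ h.2) (hits (letters_of D)).

(* The minimum of a nonempty set of natural numbers (0 for the empty set). *)
Definition nat_min (P : nat -> Prop) : nat :=
  if pselect (exists n, `[< P n >]) is left exP then ex_minn exP else 0%N.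

Definition h_plus (k : knotoid) : nat :=
  nat_min (fun m => exists D : shortcut_diagram,
    represents (diagram_of D) k /\ diagram_h_plus D = m).

Definition h_minus (k : knotoid) : nat :=
  nat_min (fun m => exists D : shortcut_diagram,
    represents (diagram_of D) k /\ diagram_h_minus D = m).

(* The part of the word strictly between the two passages through c. *)
Definition loop (c : nat) (w : seq letter) : seq letter :=
  let is_c (x : letter) := if x is inl p then label p == c else false in
  let w1 := drop (find is_c w).+1 w in
  take (find is_c w1) w1.

Definition hit_sign (h : hit) : int := if h.2 then 1 else -1.

Definition shortcut_index (D : shortcut_diagram) (c : nat) : int :=
  \sum_(h <- hits (loop c (letters_of D))) hit_sign h.

(* The intersection index does not depend on the shortcut, and every diagram   *)
(* has one, so that the second branch is never used.                           *)
Definition index (K : diagram) (c : nat) : int :=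
  if pselect (exists D, diagram_of D = K) is left exD
  then shortcut_index (projT1 (cid exD)) c else 0.

Definition crossings (K : diagram) : seq nat := undup (map label (word_of K)).

Definition crossing_sign (K : diagram) (c : nat) : int :=
  if (c, true, true) \in word_of K then 1 else -1.

(* The sum is even, so the Euclidean quotient is the exact half. *)
Definition writhe (K : diagram) (n : int) : int :=
  ((\sum_(c <- crossings K | index K c == n) crossing_sign K c) %/ 2)%Z.

(* Laurent polynomials as finitely supported functions from exponents to       *)
(* coefficients; only their additive structure is needed.                      *)
Definition laurent := {malg int[int]}.

Definition monomial (n : int) : laurent := << 1 *g n >>.

(* The writhe vanishes at all n that are not the index of some crossing. *)
Definition diagram_index_poly (K : diagram) : laurent :=
  \sum_(n <- undup (map (index K) (crossings K)) | n != 0)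
    (monomial n - monomial 0) *~ writhe K n.

(* The n-writhes of a diagram only depend on the knotoid that it represents. *)
Definition index_poly (k : knotoid) : laurent := diagram_index_poly (repr k).

Definition deg_plus (p : laurent) : int := \big[Num.max/0]_(n <- msupp p) n.

Definition deg_minus (p : laurent) : int := \big[Num.max/0]_(n <- msupp p) (- n).

(* Main.v *)
(* On the sphere every closed curve bounds, so K minus a shortcut a is the     *)
(* boundary of a function on the regions (an Alexander numbering).  Its values *)
(* to the left of K, followed along the loop at a crossing c, change by the    *)
(* signs of the crossings and by minus those of the intersections with a, and  *)
(* return to the initial value.  Hence Ind(c) is the sum of the signs of the   *)
(* passages strictly between the two visits of c, read from the Gauss word     *)
(* alone.  In these terms the invariance of the n-writhes is a computation on  *)
(* Gauss words for each Reidemeister move.  If n is an exponent of F_k, then   *)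
(* every diagram of k has a crossing of index n, and n, a sum of signs of some *)
(* of the intersections with a, is at most the number of positive ones and at  *)
(* least minus the number of negative ones.                                    *)
Require Import Defs.
From mathcomp Require Import all_boot all_order all_algebra.
From mathcomp Require Import boolp zify generic_quotient finmap monalg.
Import Order.TTheory GRing.Theory Num.Theory.
Local Open Scope ring_scope.

Set Implicit Arguments.
Unset Strict Implicit.
Unset Printing Implicit Defensive.

(** * Cycles and boundaries of a cell decomposition with Euler characteristic 2 *)

(** The index of a crossing is a signed count of some of the intersections with a shortcut, so it is
    at most their positive number and at least minus their negative number ([shortcut_index_bound]).
    It therefore suffices that a nonzero exponent n of F_k occur as an index in every shortcut
    diagram of k, and this follows from invariance of the n-writhe.

    Indices are defined through shortcuts, while Reidemeister moves act on Gauss words; the bridge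
    is homological. Euler characteristic 2 and connectedness kill the first homology
    ([cycle_is_boundary]), so the cycle formed by the diagram minus the shortcut bounds a function
    on the regions ([alexander_numbering]). Its value to the left of the diagram changes by a sign
    at each visit and agrees at the two ends of a loop. Hence the signs of passages and of hits
    balance on a loop ([loop_balance]), and the index is the [gauss_index] of the word
    ([shortcut_indexE]).

    On Gauss words, move I adds a crossing of index 0, move II adds two crossings of equal index and
    opposite signs, and move III preserves every index ([reidemeister_gauss_writhe]). A nonzero
    n-writhe thus passes to all diagrams of k, each of which has a crossing of index n
    ([index_poly_supp]). *)

Lemma rank_ge_pred (K : fieldType) m n (A : 'M[K]_(m, n)) :
  (forall x : 'rV_m, x *m A = 0 -> forall i j, x 0 i = x 0 j) ->
  (m.-1 <= \rank A)%N.
Proof.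
case: m A => [|m] A constA //.
(* The left kernel lies in the line of constant vectors, so its dimension is at most one. *)
have : (kermx A <= (const_mx 1 : 'rV_m.+1))%MS.
  apply/row_subP => i; apply/sub_rVP.
  have /constA eq_entries : row i (kermx A) *m A = 0.
    by rewrite -row_mul mulmx_ker row0.
  exists (row i (kermx A) 0 0); apply/rowP => j.
  by rewrite [LHS](eq_entries j 0) !mxE mulr1.
move/mxrankS; rewrite mxrank_ker => /leq_trans/(_ (rank_leq_row _)).
by rewrite leq_subLR addn1.
Qed.

(** Boundaries, the row space of [A], lie in the kernel of [B^T]. By Euler's formula and the rank
    bounds, the dimension of this kernel does not exceed the rank of [A], so the two spaces
    coincide. *)
Lemma cycle_is_boundary_mx (K : fieldType) v e f (A : 'M[K]_(f, e))
    (B : 'M[K]_(v, e)) (g : 'rV[K]_e) :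
  (v + f = e + 2)%N ->
  (forall x : 'rV_v, x *m B = 0 -> forall i j, x 0 i = x 0 j) ->
  (forall x : 'rV_f, x *m A = 0 -> forall i j, x 0 i = x 0 j) ->
  A *m B^T = 0 -> g *m B^T = 0 -> (g <= A)%MS.
Proof.
move=> euler /rank_ge_pred rankB /rank_ge_pred rankA AB0 gB0.
have sAker : (A <= kermx B^T)%MS by apply/sub_kermxP.
have sgker : (g <= kermx B^T)%MS by apply/sub_kermxP.
apply: submx_trans sgker _.
rewrite -(geq_leqif (mxrank_leqif_sup sAker)) mxrank_ker mxrank_tr.
have := rank_leq_col B; lia.
Qed.

(** The first two hypotheses after Euler's formula say that the graph and its dual are connected.
    Being a cycle is tested by pairing with coboundaries of functions on the vertices. *)
Lemma cycle_is_boundary (K : fieldType) (V E F : finType) (src tgt : E -> V)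
    (lft rgt : E -> F) (g : E -> K) :
  (#|V| + #|F| = #|E| + 2)%N ->
  (forall h : V -> K, (forall e, h (tgt e) = h (src e)) ->
     forall v v', h v = h v') ->
  (forall f : F -> K, (forall e, f (lft e) = f (rgt e)) ->
     forall c c', f c = f c') ->
  (forall (f : F -> K) (h : V -> K),
     \sum_e (f (lft e) - f (rgt e)) * (h (tgt e) - h (src e)) = 0) ->
  (forall h : V -> K, \sum_e g e * (h (tgt e) - h (src e)) = 0) ->
  exists f : F -> K, forall e, g e = f (lft e) - f (rgt e).
Proof.
move=> euler connV connF bd_cycle g_cycle.
pose ind (T : finType) (i : 'I_#|T|) (x : T) : K := (enum_rank x == i)%:R.
have sum_ind (T : finType) (x : 'rV[K]_#|T|) (t : T) :
    \sum_i x 0 i * ind T i t = x 0 (enum_rank t).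
  rewrite (bigD1 (enum_rank t)) //= /ind eqxx mulr1 big1 ?addr0 // => i.
  by rewrite eq_sym => /negbTE->; rewrite mulr0.
pose A := \matrix_(i < #|F|, j < #|E|)
  (ind F i (lft (enum_val j)) - ind F i (rgt (enum_val j))).
pose B := \matrix_(i < #|V|, j < #|E|)
  (ind V i (tgt (enum_val j)) - ind V i (src (enum_val j))).
have mulA (x : 'rV[K]_#|F|) j : (x *m A) 0 j =
    x 0 (enum_rank (lft (enum_val j))) - x 0 (enum_rank (rgt (enum_val j))).
  rewrite !mxE -!sum_ind -sumrB; apply: eq_bigr => i _.
  by rewrite mxE mulrBr.
have mulB (x : 'rV[K]_#|V|) j : (x *m B) 0 j =
    x 0 (enum_rank (tgt (enum_val j))) - x 0 (enum_rank (src (enum_val j))).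
  rewrite !mxE -!sum_ind -sumrB; apply: eq_bigr => i _.
  by rewrite mxE mulrBr.
have sumE (H : E -> K) : \sum_(j < #|E|) H (enum_val j) = \sum_e H e.
  by rewrite (reindex _ (onW_bij _ (enum_val_bij E))).
have /submxP[x def_g] : (\row_j g (enum_val j) <= A)%MS.
  apply: (@cycle_is_boundary_mx _ _ _ _ _ B) => //.
  - move=> x xB0 i i'; rewrite -(enum_valK i) -(enum_valK i').
    apply: (connV (fun v => x 0 (enum_rank v))) => e; apply/eqP.
    by rewrite -subr_eq0 -(enum_rankK e) -mulB xB0 mxE.
  - move=> x xA0 i i'; rewrite -(enum_valK i) -(enum_valK i').
    apply: (connF (fun v => x 0 (enum_rank v))) => e; apply/eqP.
    by rewrite -subr_eq0 -(enum_rankK e) -mulA xA0 mxE.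
  - apply/matrixP => i i'; rewrite !mxE -[RHS](bd_cycle (ind F i) (ind V i')) -sumE.
    by apply: eq_bigr => j _; rewrite !mxE.
  - apply/rowP => i'; rewrite !mxE -[RHS](g_cycle (ind V i')) -sumE.
    by apply: eq_bigr => j _; rewrite !mxE.
exists (fun c => x 0 (enum_rank c)) => e.
by have /rowP/(_ (enum_rank e)) := def_g; rewrite mulA mxE enum_rankK.
Qed.

Lemma big_seq_sub (R : nmodType) (T : choiceType) (s : seq T) (F : T -> R) :
  uniq s -> \sum_(x : seq_sub s) F (val x) = \sum_(x <- s) F x.
Proof.
move=> us; rewrite -[in RHS](val_seq_sub_enum us) big_map.
apply/perm_big/uniq_perm => [||x]; first exact: index_enum_uniq.
  exact: undup_uniq.
by rewrite mem_index_enum mem_seq_sub_enum.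
Qed.

(** * Darts of a pair of strands *)

Lemma uniq_map_inj_in (T1 T2 : eqType) (f : T1 -> T2) (s : seq T1) :
  uniq (map f s) -> {in s &, injective f}.
Proof.
elim: s => //= x s IHs /andP[fx_notin us] y z.
have fxN t : t \in s -> f x <> f t.
  by move=> ts fxt; rewrite fxt map_f in fx_notin.
rewrite !inE => /predU1P[->|ys] /predU1P[->|zs] //.
- by move/fxN => /(_ zs).
- by move/esym/fxN => /(_ ys).
- exact: IHs.
Qed.

Arguments next_dart : simpl never.

Section Strands.

Variable L : choiceType.
Implicit Types (S : seq (seq (L * bool))) (p q : nat * nat) (d : dart).

Definition visit S p : option (L * bool) := onth (strand S p.1) p.2.

(** The two branches at a double point see each other pass in opposite directions, so visits pair
    off by negating the boolean. *)
Definition double_word S : bool :=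
  uniq (flatten S) && all (fun x => (x.1, ~~ x.2) \in flatten S) (flatten S).

Lemma mem_positions S p :
  (p \in positions S) = (p.1 < size S)%N && (p.2 < size (strand S p.1))%N.
Proof.
apply/allpairsPdep/idP => [[s [i []]]|/andP[lt_s lt_i]].
  by rewrite !mem_iota /= !add0n => lt_s lt_i ->; rewrite lt_s.
by exists p.1, p.2; rewrite !mem_iota -surjective_pairing.
Qed.

Lemma visitP S p : reflect (exists x, visit S p = Some x)
  (p.2 < size (strand S p.1))%N.
Proof.
rewrite /visit -onthTE; case: onth => [x|]; constructor; first by exists x.
by case.
Qed.

Lemma visit_positions S p x : visit S p = Some x -> p \in positions S.
Proof.
move=> vp; have lt_p : (p.2 < size (strand S p.1))%N by apply/visitP; exists x.
rewrite mem_positions lt_p andbT ltnNge; apply/negP => le_p.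
by rewrite /strand nth_default in lt_p.
Qed.

Lemma map_visit_positions S : map (visit S) (positions S) = map some (flatten S).
Proof.
rewrite map_allpairs -[in RHS](mkseq_nth [::] S) map_flatten /mkseq -map_comp.
congr flatten; apply: eq_map => s /=; rewrite -/(strand S s).
apply: (@eq_from_nth _ None) => [|i]; rewrite !size_map size_iota // => lt_i.
by rewrite (nth_map 0%N) ?size_iota // nth_iota // -onthE.
Qed.

Lemma mem_flattenP S x :
  reflect (exists p, visit S p = Some x) (x \in flatten S).
Proof.
rewrite -(mem_map (@Some_inj _)) -map_visit_positions.
apply: (iffP mapP) => [[p _ ->]|[p vp]]; first by exists p.
by exists p; rewrite ?(visit_positions vp).
Qed.

Lemma visit_inj S p q x : double_word S ->
  visit S p = Some x -> visit S q = Some x -> p = q.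
Proof.
move=> /andP[uS _] vp vq.
have inj_v : {in positions S &, injective (visit S)}.
  by apply: uniq_map_inj_in; rewrite map_visit_positions map_inj_uniq // => ? ? [].
by apply: inj_v; rewrite ?(visit_positions vp) ?(visit_positions vq) // vp.
Qed.

Lemma visit_other_position S p x b : double_word S ->
  visit S p = Some (x, b) -> visit S (other_position S p) = Some (x, ~~ b).
Proof.
move=> dS vp; have /andP[_ /allP/(_ (x, b))] := dS.
case/(_ _)/mem_flattenP => [|q vq]; first by apply/mem_flattenP; exists p.
rewrite /other_position; set s := filter _ _.
have sq : q \in s.
  rewrite mem_filter (visit_positions vq) andbT /point_at -/(visit S q).
  rewrite -/(visit S p) vp vq eqxx andbT; apply/eqP => def_q.
  by move: vq; rewrite def_q vp => -[]; case: (b).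
suff : head p s \in s.
  rewrite mem_filter /point_at -/(visit S _) -/(visit S p) vp.
  case/andP => /andP[neq_p /eqP/=]; case v: (visit S _) => [[y c]|] //= [eq_yx] _.
  rewrite eq_yx in v *; congr (Some (x, _)); apply/eqP.
  have : b != c; last by case: (b) (c) => [] [].
  apply: contraNneq neq_p => def_b; apply/eqP; apply: visit_inj dS v _.
  by rewrite vp def_b.
by case: (s) sq => // r s' _; apply: mem_head.
Qed.

Lemma other_positionK S p x : double_word S ->
  visit S p = Some x -> other_position S (other_position S p) = p.
Proof.
case: x => x b dS vp; apply: visit_inj (dS) _ (vp).
have /(visit_other_position dS) := visit_other_position dS vp.
by rewrite negbK.
Qed.

Lemma next_dart_forward S s i x b : visit S (s, i) = Some (x, b) ->
  next_dart S (s, i, true) =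
    let q := other_position S (s, i) in
    if b then (q.1, q.2, false) else (q.1, q.2.+1, true).
Proof.
move=> v; have /ltn_eqF/= neq_i : (i < size (strand S s))%N.
  by apply/(visitP S (s, i)); exists (x, b).
rewrite /next_dart neq_i -odflt_onth onth_map.
by rewrite [onth _ _]v; case: b {v}.
Qed.

Lemma next_dart_backward S s i x b : visit S (s, i) = Some (x, b) ->
  next_dart S (s, i.+1, false) =
    let q := other_position S (s, i) in
    if b then (q.1, q.2.+1, true) else (q.1, q.2, false).
Proof. by move=> v; rewrite /next_dart /= -odflt_onth onth_map [onth _ _]v. Qed.

Definition reverse d : dart := (d.1, ~~ d.2).

(** The turn from one dart to the next among those that end at the same vertex. *)
Definition rotate S d : dart := reverse (next_dart S d).

Lemma rotate2_forward S s i x : double_word S -> visit S (s, i) = Some x ->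
  rotate S (rotate S (s, i, true)) = (s, i.+1, false).
Proof.
case: x => x b dS v; rewrite /rotate (next_dart_forward v).
have v' := visit_other_position dS v; have := other_positionK dS v.
case: (other_position S (s, i)) v' => t j /= v' def_si; case: b v v' => v v'.
  by rewrite /reverse /= (next_dart_forward v') def_si.
by rewrite /reverse /= (next_dart_backward v') def_si.
Qed.

Lemma rotate2_backward S s i x : double_word S -> visit S (s, i) = Some x ->
  rotate S (rotate S (s, i.+1, false)) = (s, i, true).
Proof.
case: x => x b dS v; rewrite /rotate (next_dart_backward v).
have v' := visit_other_position dS v; have := other_positionK dS v.
case: (other_position S (s, i)) v' => t j /= v' def_si; case: b v v' => v v'.
  by rewrite /reverse /= (next_dart_backward v') def_si.
by rewrite /reverse /= (next_dart_forward v') def_si.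
Qed.

Definition edges S : seq (nat * nat) :=
  [seq (s, i) | s <- iota 0 (size S), i <- iota 0 (size (strand S s)).+1].

Lemma mem_edges S e :
  (e \in edges S) = (e.1 < size S)%N && (e.2 <= size (strand S e.1))%N.
Proof.
apply/allpairsPdep/idP => [[s [i []]]|/andP[lt_s lt_i]].
  by rewrite !mem_iota /= !add0n ltnS => lt_s lt_i ->; rewrite lt_s.
by exists e.1, e.2; rewrite !mem_iota /= ltnS lt_s lt_i -surjective_pairing.
Qed.

Lemma edges_uniq S : uniq (edges S).
Proof.
apply: allpairs_uniq_dep.
- exact: iota_uniq.
- by move=> s _; apply: iota_uniq.
- by move=> [s i] [t j] _ _ /= [-> ->].
Qed.

Lemma size_edges S : size (edges S) = num_edges S.
Proof.
rewrite size_allpairs_dep /num_edges -(big_map (fun w => (size w).+1) xpredT id).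
rewrite -sumnE; congr sumn; rewrite -[in RHS](mkseq_nth [::] S) -map_comp.
by apply: eq_map => s /=; rewrite size_iota.
Qed.

Lemma mem_darts S d : (d \in darts S) = (d.1 \in edges S).
Proof.
apply/allpairsP/idP => [[[e b] /= [es _ -> //]]|es].
by exists d; rewrite es -surjective_pairing; case: d.2.
Qed.

Lemma darts_uniq S : uniq (darts S).
Proof.
apply: allpairs_uniq => //; first exact: edges_uniq.
by move=> [e b] [e' b'] _ _ /= [-> ->].
Qed.

(** The vertex where edge [i] of strand [s] starts; [inl false] stands for v0 and [inl true] for
    v1. *)
Definition node S (s i : nat) : bool + L :=
  if i is j.+1 then if visit S (s, j) is Some x then inr x.1 else inl true
  else inl false.

Definition source S d : bool + L :=
  if d.2 then node S d.1.1 d.1.2 else node S d.1.1 d.1.2.+1.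

Definition target S d : bool + L := source S (reverse d).

End Strands.

Section SphericalStrands.

Variable L : choiceType.
Implicit Types (S : seq (seq (L * bool))) (d : dart).

(** Cases according to where the dart ends: at v1, at v0, or at a double point reached forwards or
    backwards. *)
Lemma dartP S d : d \in darts S ->
  [\/ exists2 s, (s < size S)%N & d = (s, size (strand S s), true),
      exists2 s, (s < size S)%N & d = (s, 0%N, false),
      exists s i x, visit S (s, i) = Some x /\ d = (s, i, true)
    | exists s i x, visit S (s, i) = Some x /\ d = (s, i.+1, false)].
Proof.
rewrite mem_darts mem_edges; case: d => [[s i] b] /= /andP[lt_s].
have vis j : (j < size (strand S s))%N -> exists x, visit S (s, j) = Some x.
  by move=> lt_j; apply/(visitP S (s, j)).
case: b => [|le_i].
  rewrite leq_eqVlt => /predU1P[->|/vis[x v]]; first by constructor 1; exists s.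
  by constructor 3; exists s, i, x.
case: i le_i => [|i /vis[x v]]; first by constructor 2; exists s.
by constructor 4; exists s, i, x.
Qed.

Lemma next_dart_end S s : next_dart S (s, size (strand S s), true) =
  let s' := (s.+1 %% size S)%N in (s', size (strand S s'), false).
Proof. by rewrite /next_dart eqxx. Qed.

Lemma next_dart_start S s : next_dart S (s, 0%N, false) =
  ((s.+1 %% size S)%N, 0%N, true).
Proof. by []. Qed.

Lemma next_dart_mem S d : double_word S ->
  d \in darts S -> next_dart S d \in darts S.
Proof.
move=> dS /dartP.
have turn_mem p q x (b : bool) : visit S p = Some x -> q = other_position S p ->
    (if b then (q.1, q.2.+1, true) else (q.1, q.2, false)) \in darts S.
  case: x => x c /(visit_other_position dS)/visit_positions.
  rewrite mem_positions => /andP[q1 q2] ->.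
  by case: b; rewrite mem_darts mem_edges /= q1 //= ltnW.
case=> [[s s_lt ->]|[s s_lt ->]|[s [i [[x b] [v ->]]]]|[s [i [[x b] [v ->]]]]].
- rewrite next_dart_end mem_darts mem_edges /= leqnn andbT ltn_mod.
  exact: leq_ltn_trans s_lt.
- rewrite next_dart_start mem_darts mem_edges /= andbT ltn_mod.
  exact: leq_ltn_trans s_lt.
- rewrite (next_dart_forward v) /=; have := turn_mem _ _ _ (~~ b) v erefl.
  by case: (b).
- by rewrite (next_dart_backward v); apply: turn_mem v _.
Qed.

Lemma source_next_dart S d : double_word S -> d \in darts S ->
  source S (next_dart S d) = target S d.
Proof.
move=> dS /dartP.
case=> [[s s_lt ->]|[s s_lt ->]|[s [i [[x b] [v ->]]]]|[s [i [[x b] [v ->]]]]].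
- by rewrite next_dart_end /target /source /= /visit /= !onth_default.
- by rewrite next_dart_start.
- rewrite (next_dart_forward v) /=; have := visit_other_position dS v.
  by case: b v => v; case: other_position => t j; rewrite /target /source /= v => ->.
- rewrite (next_dart_backward v) /=; have := visit_other_position dS v.
  by case: b v => v; case: other_position => t j; rewrite /target /source /= v => ->.
Qed.

(** Double points have degree 4, while v0 and v1 have degree 2 since there are two strands; both
    degrees divide 4. *)
Lemma rotate4 S d : size S = 2%N -> double_word S -> d \in darts S ->
  iter 4 (rotate S) d = d.
Proof.
move=> S2 dS /dartP.
case=> [[s s_lt ->]|[s s_lt ->]|[s [i [x [v ->]]]]|[s [i [x [v ->]]]]] /=.
- rewrite S2 in s_lt.
  have rot2 t : (t < 2)%N -> rotate S (rotate S (t, size (strand S t), true)) =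
      (t, size (strand S t), true).
    have e0 : next_dart S (0%N, size (strand S 0), true) =
        (1%N, size (strand S 1), false) by rewrite next_dart_end S2.
    have e1 : next_dart S (1%N, size (strand S 1), true) =
        (0%N, size (strand S 0), false) by rewrite next_dart_end S2.
    by case: t => [|[|]] // _; rewrite /rotate /reverse ?(e0, e1) /= ?(e0, e1).
  by rewrite !rot2.
- rewrite S2 in s_lt.
  have rot2 t : (t < 2)%N -> rotate S (rotate S (t, 0%N, false)) = (t, 0%N, false).
    have e0 : next_dart S (0%N, 0%N, false) = (1%N, 0%N, true).
      by rewrite next_dart_start S2.
    have e1 : next_dart S (1%N, 0%N, false) = (0%N, 0%N, true).
      by rewrite next_dart_start S2.
    by case: t => [|[|]] // _; rewrite /rotate /reverse ?(e0, e1) /= ?(e0, e1).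
  by rewrite !rot2.
- by rewrite (rotate2_forward dS v) (rotate2_backward dS v).
- by rewrite (rotate2_backward dS v) (rotate2_forward dS v).
Qed.

Lemma next_dart_inj S : size S = 2%N -> double_word S ->
  {in darts S &, injective (next_dart S)}.
Proof.
move=> S2 dS d d' dd dd' eq_next.
rewrite -(rotate4 S2 dS dd) -(rotate4 S2 dS dd') !iterSr.
by rewrite /rotate -/(rotate S) eq_next.
Qed.

(* Two rotations around a double point lead to the next edge of the strand. *)
Lemma invariant_const S (K : eqType) (k : dart -> K) :
  size S = 2%N -> double_word S ->
  {in darts S, forall d, k (next_dart S d) = k d} ->
  {in darts S, forall d, k (reverse d) = k d} ->
  {in darts S &, forall d d', k d = k d'}.
Proof.
move=> S2 dS k_next k_rev.
have k_rot d : d \in darts S -> k (rotate S d) = k d.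
  by move=> dd; rewrite k_rev ?k_next ?next_dart_mem.
have rot_mem d : d \in darts S -> rotate S d \in darts S.
  by move=> dd; rewrite /rotate mem_darts /= -mem_darts next_dart_mem.
suff k0 d : d \in darts S -> k d = k (0%N, 0%N, true).
  by move=> d d' dd dd'; rewrite !k0.
have k_edge s i : (s < size S)%N -> (i <= size (strand S s))%N ->
    k (s, i, true) = k (s, 0%N, true).
  move=> lt_s; elim: i => // i IHi lt_i; rewrite -IHi 1?ltnW //.
  have /(visitP S (s, i))[x v] := lt_i.
  have di : (s, i, true) \in darts S by rewrite mem_darts mem_edges lt_s ltnW.
  rewrite -[RHS](k_rot _ di) -[RHS]k_rot ?rot_mem // (rotate2_forward dS v).
  by rewrite -[RHS]k_rev // mem_darts mem_edges lt_s.
have k_true e : e \in edges S -> k (e, true) = k (0%N, 0%N, true).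
  case: e => s i; rewrite mem_edges => /andP[/= lt_s le_i]; rewrite k_edge //.
  rewrite S2 in lt_s; case: s lt_s {le_i} => [|[|]] //= _.
  (* Turning around v0 links the first edges of the two strands. *)
  have d0 : (0%N, 0%N, false) \in darts S by rewrite mem_darts mem_edges S2.
  by have := k_next _ d0; rewrite next_dart_start S2 => ->; rewrite -k_rev.
move=> dd; have ed : d.1 \in edges S by rewrite -mem_darts.
rewrite -(k_true _ ed); case: d ed {dd} => e [] //= ed.
by rewrite -k_rev // mem_darts.
Qed.

End SphericalStrands.

(** * Alexander numbering *)

Section Numbering.

Variable L : choiceType.
Implicit Types (S : seq (seq (L * bool))) (d : dart).

Lemma sum_darts (R : nmodType) S (F : dart -> R) :
  \sum_(d <- darts S) F d = \sum_(e <- edges S) (F (e, true) + F (e, false)).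
Proof.
rewrite /darts big_allpairs_dep; apply: eq_bigr => e _.
by rewrite !big_cons big_nil /= addr0.
Qed.

(** A boundary is a cycle: written as a sum over darts, the terms at sources, reindexed along
    [next_dart], cancel those at targets, because [k] is constant along each face. *)
Lemma sum_boundary (R : comPzRingType) S (k : dart -> R) (h : bool + L -> R) :
  size S = 2%N -> double_word S ->
  {in darts S, forall d, k (next_dart S d) = k d} ->
  \sum_(e <- edges S) (k (e, true) - k (e, false)) *
    (h (target S (e, true)) - h (source S (e, true))) = 0.
Proof.
move=> S2 dS k_next.
transitivity (\sum_(d <- darts S) k d * (h (target S d) - h (source S d))).
  rewrite sum_darts; apply: eq_bigr => e _.
  by rewrite -[h (target S (e, false)) - _]opprB mulrN mulrBl.
have perm_next : perm_eq (map (next_dart S) (darts S)) (darts S).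
  have u_next : uniq (map (next_dart S) (darts S)).
    by rewrite map_inj_in_uniq ?darts_uniq //; apply: next_dart_inj.
  apply: uniq_perm (u_next) (darts_uniq S) _.
  have sub_next : {subset map (next_dart S) (darts S) <= darts S}.
    by move=> _ /mapP[d dd ->]; apply: next_dart_mem.
  by case: (uniq_min_size u_next sub_next); rewrite ?size_map.
under eq_bigr do rewrite mulrBr.
rewrite sumrB; apply/eqP; rewrite subr_eq0 -[X in _ == X](perm_big _ perm_next) /=.
rewrite big_map; apply/eqP/eq_big_seq => d dd.
by rewrite k_next // source_next_dart.
Qed.

Lemma sum_strand (R : comPzRingType) S s (h : bool + L -> R) :
  \sum_(i <- iota 0 (size (strand S s)).+1)
    (h (target S (s, i, true)) - h (source S (s, i, true))) =
  h (inl true) - h (inl false).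
Proof.
have := @telescope_sumr R 0 (size (strand S s)).+1 (fun i => h (node S s i)) isT.
by rewrite /index_iota subn0 /= /visit onth_default.
Qed.

(** Both strands run from v0 to v1, so their difference is a cycle and hence a boundary. The value
    of [k] at a dart is that of the region to its left; it is rational because the rank argument
    takes place over a field. *)
Lemma alexander_numbering S :
  size S = 2%N -> double_word S -> spherical S ->
  exists k : dart -> rat,
    {in darts S, forall d, k (next_dart S d) = k d} /\
    {in edges S, forall e, k (e, true) - k (e, false) = (-1) ^+ e.1}.
Proof.
move=> S2 dS sphS.
pose labels := undup (map fst (flatten S)).
pose V : finType := (bool + seq_sub labels)%type.
pose vertex (v : bool + L) : V :=
  match v with inl b => inl b | inr x => oapp inr (inl true) (insub x) end.
pose phi (x : seq_sub (darts S)) : seq_sub (darts S) :=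
  SeqSub (next_dart_mem dS (valP x)).
have phi_inj : injective phi.
  move=> x y /(congr1 val) /= eq_next; apply: val_inj.
  exact: next_dart_inj S2 dS _ _ (valP x) (valP y) eq_next.
have phi_sym := fconnect_sym phi_inj.
(* Faces are the orbits of [phi], each represented by its root, so that they are counted by
   [num_faces]. *)
pose F : finType := {x | froots phi x}.
pose face x : F := exist _ (froot phi x) (roots_root phi_sym x).
have face_phi x : face (phi x) = face x.
  by apply: val_inj; apply/eqP; rewrite /= root_connect // phi_sym fconnect1.
have face_val (c : F) : face (val c) = c.
  by apply: val_inj; apply/eqP; case: c.
pose E : finType := seq_sub (edges S).
have dartE (e : E) b : (val e, b) \in darts S by rewrite mem_darts (valP e).
pose side b (e : E) : seq_sub (darts S) := SeqSub (dartE e b).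
pose raw (f : F -> rat) d : rat := oapp (f \o face) 0 (insub d).
have rawE f (x : seq_sub (darts S)) : raw f (val x) = f (face x).
  by rewrite /raw valK.
have raw_next f : {in darts S, forall d, raw f (next_dart S d) = raw f d}.
  move=> d dd; pose x : seq_sub (darts S) := SeqSub dd.
  by rewrite -[d]/(val x) -[next_dart _ _]/(val (phi x)) !rawE face_phi.
pose src (e : E) := vertex (source S (val e, true)).
pose tgt (e : E) := vertex (target S (val e, true)).
pose g (e : E) : rat := (-1) ^+ (val e).1.
have [||||| f gE] := @cycle_is_boundary _ V E F src tgt
  (face \o side true) (face \o side false) g.
- have -> : #|V| = num_vertices S.
    by rewrite card_sum card_bool card_seq_sub ?undup_uniq.
  have -> : #|E| = num_edges S by rewrite card_seq_sub ?edges_uniq ?size_edges.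
  rewrite -(eqP sphS); congr (_ + _)%N; rewrite card_sig /num_faces.
  have eq_e : frel phi =2 [rel d d' | next_dart S (val d) == val d'] by [].
  rewrite /num_faces -(eq_n_comp (eq_connect eq_e)) /n_comp_mem.
  by apply eq_card => x; apply: esym (andbT _).
- move=> h h_edge.
  (* The graph is connected: each strand is a path from v0, and every double point lies on a
     strand. *)
  have h_node s i : (s < size S)%N -> (i <= (size (strand S s)).+1)%N ->
      h (vertex (node S s i)) = h (inl false).
    move=> lt_s; elim: i => // i IHi lt_i; rewrite -IHi 1?ltnW //.
    have es : (s, i) \in edges S by rewrite mem_edges lt_s.
    exact: h_edge (SeqSub es).
  suff h0 v : h v = h (inl false) by move=> v v'; rewrite !h0.
  case: v => [[]|x] //.
    have := h_node 0%N (size (strand S 0)).+1; rewrite S2 /= /visit onth_default //.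
    exact.
  have := valP x; rewrite mem_undup => /mapP[y /mem_flattenP[[s i] v] def_x].
  have := h_node s i.+1; rewrite /= v /= -def_x valK; apply.
    by have := visit_positions v; rewrite mem_positions => /andP[].
  by rewrite ltnS ltnW //; apply/(visitP S (s, i)); exists y.
- move=> f f_side c c'; rewrite -(face_val c) -(face_val c') -!rawE.
  apply: (invariant_const S2 dS (raw_next f)); try exact: valP.
  move=> [e b] dd; have ee : e \in edges S by move: dd; rewrite mem_darts.
  have := f_side (SeqSub ee); rewrite /= -!rawE /= /reverse /=.
  by case: (b) => ->.
- move=> f h; rewrite -[RHS](@sum_boundary _ S (raw f) (h \o vertex)) //.
  rewrite -[RHS]big_seq_sub ?edges_uniq //; apply: eq_bigr => e _.
  by rewrite -!rawE.
- move=> h; pose H e : rat := (-1) ^+ e.1 *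
    (h (vertex (target S (e, true))) - h (vertex (source S (e, true)))).
  transitivity (\sum_(e <- edges S) H e).
    by rewrite -[RHS]big_seq_sub ?edges_uniq.
  have sum_H s : \sum_(i <- iota 0 (size (strand S s)).+1) H (s, i) =
      (-1) ^+ s * (h (inl true) - h (inl false)).
    by rewrite -[_ - _](sum_strand S s (h \o vertex)) mulr_sumr.
  rewrite big_allpairs_dep S2; under eq_bigr do rewrite sum_H.
  by rewrite !big_cons big_nil /= expr0 expr1 mul1r mulN1r addr0 subrr.
exists (raw f); split=> // e ee.
by have := gE (SeqSub ee); rewrite /= -!rawE => <-.
Qed.

End Numbering.

(** * Indices of crossings from the Gauss word *)

Section Levels.

Variables (L : choiceType) (S : seq (seq (L * bool))) (k : dart -> rat).
Hypothesis dS : double_word S.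
Hypothesis k_next : {in darts S, forall d, k (next_dart S d) = k d}.
Hypothesis k_jump :
  {in edges S, forall e, k (e, true) - k (e, false) = (-1) ^+ e.1}.

Definition bsign (b : bool) : int := if b then 1 else -1.

Lemma visit_edges p x : visit S p = Some x ->
  (p \in edges S) && ((p.1, p.2.+1) \in edges S).
Proof.
move/visit_positions; rewrite mem_positions !mem_edges /= => /andP[-> lt_p].
by rewrite lt_p ltnW.
Qed.

(** The regions to the left of the strand before and after the visit are separated by an edge of the
    other branch, the one before the double point if [b] holds and the one after it otherwise. *)
Lemma level_step s i x b : visit S (s, i) = Some (x, b) ->
  k (s, i.+1, true) - k (s, i, true) =
  (bsign b)%:~R * (-1) ^+ (other_position S (s, i)).1.
Proof.
move=> v; have v' := visit_other_position dS v; have K := other_positionK dS v.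
have := next_dart_forward v.
case: (other_position S (s, i)) v' K => t j v' K /= next_in.
have /andP[es _] := visit_edges v; have /andP[et et1] := visit_edges v'.
have -> : k (s, i, true) = k (next_dart S (s, i, true)).
  by rewrite k_next // mem_darts.
rewrite next_in; case: b v v' {next_in} => v v' /=.
  rewrite mul1r -(k_jump et); congr (_ - _).
  by rewrite -[RHS]k_next ?mem_darts // (next_dart_forward v') K.
rewrite mulN1r -(k_jump et1) opprB; congr (_ - _).
by rewrite -[RHS]k_next ?mem_darts // (next_dart_backward v') K.
Qed.

(** If [b] holds, both darts border the same corner. Otherwise the corners are opposite, and each is
    reached from the corner to the left of edge [i] by crossing an edge of strand [s] from left to
    right, so the levels still agree. *)
Lemma level_corner s i j x b : visit S (s, i) = Some (x, b) ->
  other_position S (s, i) = (s, j) -> k (s, i.+1, true) = k (s, j, true).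
Proof.
move=> v other; have v' := visit_other_position dS v.
have K := other_positionK dS v; rewrite other in v' K.
have /andP[es _] := visit_edges v; have /andP[et et1] := visit_edges v'.
case: b v v' => v v'.
  by rewrite -[RHS]k_next ?mem_darts // (next_dart_forward v') K.
have /eqP := level_step v; rewrite other mulN1r subr_eq => /eqP->.
rewrite -[k (s, j, true)]k_next ?mem_darts // (next_dart_forward v') K /=.
by rewrite -(k_jump es) opprB subrK.
Qed.

Lemma loop_level_sum s i j x b : (i < j)%N -> visit S (s, i) = Some (x, b) ->
  other_position S (s, i) = (s, j) ->
  \sum_(i.+1 <= m < j)
    (bsign (oapp snd false (visit S (s, m))))%:~R *
      (-1) ^+ (other_position S (s, m)).1 = 0 :> rat.
Proof.
move=> lt_ij v other; have v' := visit_other_position dS v; rewrite other in v'.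
have lt_j : (j < size (strand S s))%N by apply/(visitP S (s, j)); exists (x, ~~ b).
transitivity (\sum_(i.+1 <= m < j) (k (s, m.+1, true) - k (s, m, true))).
  apply: eq_big_nat => m /andP[_ lt_m].
  have /(visitP S (s, m))[[y c] vm] := ltn_trans lt_m lt_j.
  by rewrite vm (level_step vm).
by rewrite telescope_sumr // (level_corner v other) subrr.
Qed.

End Levels.

(* Positive when the passage goes from the right to the left of the other branch. *)
Definition psign (p : passage) : int := bsign (is_over p (+) is_positive p).

Lemma gauss_word_same_label w p q : gauss_word w -> p \in w -> q \in w ->
  label p = label q -> q = p \/ q = other_passage p.
Proof.
case/andP=> /uniq_map_inj_in inj_w /allP oth pw qw eq_l.
have [eq_o|neq_o] := eqVneq (is_over p) (is_over q); [left|right].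
  by apply: inj_w; rewrite // eq_l eq_o.
apply: inj_w => //; first exact: oth.
rewrite -eq_l; congr (_, _); rewrite [RHS]/(~~ is_over p).
by case: (is_over p) (is_over q) neq_o => [] [].
Qed.

Lemma gauss_word_uniq w : gauss_word w -> uniq w.
Proof. by case/andP=> /map_uniq. Qed.

Lemma gauss_word_count w p : gauss_word w -> p \in w ->
  count (fun q => label q == label p) w = 2%N.
Proof.
move=> gw pw; have /allP oth : all (fun p => other_passage p \in w) w.
  by case/andP: gw.
rewrite -size_filter -[RHS](_ : size [:: p; other_passage p] = 2%N) //.
apply/perm_size/uniq_perm; first by rewrite filter_uniq // gauss_word_uniq.
  by case: (p) => [[c []] o]; rewrite /= andbT inE; apply/eqP => -[].
move=> q; rewrite mem_filter !inE; apply/andP/orP => [[/eqP eq_l qw]|].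
  by case: (gauss_word_same_label gw pw qw (esym eq_l)) => ->; rewrite eqxx; auto.
by case=> /eqP ->; rewrite ?eqxx ?oth.
Qed.

Lemma mem_passages w p : (p \in passages w) = (inl p \in w).
Proof. by elim: w => //= -[q|h] w IHw; rewrite !inE ?IHw. Qed.

Lemma mem_hits w h : (h \in hits w) = (inr h \in w).
Proof. by elim: w => //= -[q|g] w IHw; rewrite !inE ?IHw. Qed.

Lemma flat_passage_inj w : gauss_word w -> {in w &, injective flat_passage}.
Proof.
move=> gw p q pw qw [eq_l].
have [->//|->] := gauss_word_same_label gw pw qw eq_l.
by case: p {pw eq_l} => [[c []] []].
Qed.

Lemma double_word_shortcut w (a : seq hit) : gauss_word (passages w) ->
  uniq (map fst (hits w)) -> perm_eq a (hits w) ->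
  double_word [:: map flat_letter w; map flat_hit a].
Proof.
move=> gw uh pa; rewrite /double_word /= cats0.
have hits_inj : {in hits w &, injective fst} by apply: uniq_map_inj_in.
have uw : uniq w.
  move: (gauss_word_uniq gw) (map_uniq uh).
  elim: (w) => //= -[p|h] v IHv /=.
    by move=> /andP[pw uv] uhv; rewrite -mem_passages pw IHv.
  by move=> uv /andP[hv uhv]; rewrite -mem_hits hv IHv.
apply/andP; split.
  rewrite cat_uniq map_inj_in_uniq ?uw /=; last first.
    move=> [p|h] [q|g] //=; rewrite -?mem_passages -?mem_hits => pw qw.
      by move=> eq_f; congr inl; apply: (flat_passage_inj gw) eq_f.
    by case=> eq1 eq2; congr inr; apply: hits_inj.
  apply/andP; split; last first.
    rewrite map_inj_in_uniq ?(perm_uniq pa) ?(map_uniq uh) // => h g.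
    by rewrite !(perm_mem pa) => hw gw' [eq1 _]; apply: hits_inj.
  apply/hasPn => _ /mapP[h ha ->]; apply/negP => /mapP[[p|g]] // gw' [eq1 eq2].
  have eq_hg : h = g.
    by apply: hits_inj; rewrite -?(perm_mem pa) // (perm_mem pa) mem_hits.
  by move: eq2; rewrite eq_hg; case: g.2.
apply/allP => x; rewrite mem_cat => /orP[]/mapP[].
  case=> [p|h]; rewrite -?mem_passages -?mem_hits => xw -> /=.
    rewrite mem_cat; apply/orP; left; apply/mapP.
    exists (inl (other_passage p)).
      by rewrite -mem_passages; case/andP: gw => _ /allP->.
    by case: p {xw} => [[c []] []].
  rewrite mem_cat; apply/orP; right; apply/mapP; exists h => //.
  by rewrite (perm_mem pa).
move=> h ha -> /=; rewrite mem_cat; apply/orP; left; apply/mapP.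
by exists (inr h); rewrite -?mem_hits -?(perm_mem pa) ?negbK //= negbK.
Qed.

Definition is_crossing (c : nat) (x : letter) : bool :=
  if x is inl p then label p == c else false.

(** The change of level at a letter; hits count negatively because the shortcut has coefficient -1
    in the cycle. *)
Definition letter_sign (x : letter) : int :=
  match x with inl p => psign p | inr h => - hit_sign h end.

Lemma count2_split (T : Type) (P : pred T) (s : seq T) : count P s = 2%N ->
  exists u x v y t, [/\ s = u ++ x :: v ++ y :: t, P x, P y &
    [/\ ~~ has P u, ~~ has P v & ~~ has P t]].
Proof.
have split1 n s' : count P s' = n.+1 -> exists u x t,
    [/\ s' = u ++ x :: t, P x, ~~ has P u & count P t = n].
  elim: s' => //= x s' IHs; case Px: (P x).
    by rewrite add1n => -[<-]; exists [::], x, s'.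
  rewrite add0n => /IHs[u [y [t [-> Py Pu Pt]]]].
  by exists (x :: u), y, t; rewrite /= Px.
case/split1 => u [x [s' [-> Px Pu /split1[v [y [t [-> Py Pv Pt]]]]]]].
by exists u, x, v, y, t; split=> //; split=> //; rewrite has_count Pt.
Qed.

Lemma loop_cat c u x v y t : is_crossing c x -> is_crossing c y ->
  ~~ has (is_crossing c) u -> ~~ has (is_crossing c) v ->
  loop c (u ++ x :: v ++ y :: t) = v.
Proof.
move=> cx cy cu cv; rewrite /loop -/(is_crossing c).
rewrite find_cat (negbTE cu) /= cx addn0 -cat_rcons.
rewrite drop_size_cat ?size_rcons // find_cat (negbTE cv) /= cy addn0.
by rewrite take_size_cat.
Qed.

Section Balance.

Variables (w : seq letter) (a : seq hit).
Hypotheses (gw : gauss_word (passages w)) (uh : uniq (map fst (hits w))).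
Hypothesis pa : perm_eq a (hits w).
Let S := [:: map flat_letter w; map flat_hit a].

Let dS : double_word S := double_word_shortcut gw uh pa.

Lemma visit_onth m z : onth w m = Some z -> visit S (0%N, m) = Some (flat_letter z).
Proof. by move=> wm; rewrite /visit /= onth_map wm. Qed.

(* The other branch is the diagram at a crossing and the shortcut at a hit. *)
Lemma letter_signE m z : onth w m = Some z ->
  (bsign (oapp snd false (visit S (0%N, m))))%:~R *
    (-1) ^+ (other_position S (0%N, m)).1 = (letter_sign z)%:~R :> rat.
Proof.
move=> wm; have v := visit_onth wm; rewrite v /=.
have wz : z \in w by apply/onthP; exists m.
have := @visit_other_position _ S (0%N, m) (flat_letter z).1 (flat_letter z).2 dS.
rewrite -surjective_pairing => /(_ v).
case: (other_position S (0%N, m)) => -[|[|s]] n; rewrite /visit /= ?onth_map.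
  case wn: (onth w n) => [y|] //= -[].
  have wy : y \in w by apply/onthP; exists n.
  case: z y wz wy {v wm wn} => [p|h] [q|g] //= hw gh; first by rewrite mulr1.
  (* A hit occurs only once along the diagram, so its other visit cannot lie on strand 0. *)
  move=> [eq1 eq2]; have eq_g : g = h.
    by apply: (uniq_map_inj_in uh); rewrite ?mem_hits.
  by move: eq2; rewrite eq_g; case: h.2.
case wn: (onth a n) => [h'|] //= -[].
case: z {wz v wm} => [p|h] //= _.
by rewrite mulrN1 /hit_sign /bsign; case: h.2; rewrite mulrNz.
by rewrite /strand nth_nil onth0n.
Qed.

Lemma loop_balance c u x v y t : spherical S -> w = u ++ x :: v ++ y :: t ->
  is_crossing c x -> is_crossing c y -> \sum_(z <- v) letter_sign z = 0.
Proof.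
move=> sphS def_w; case: x def_w => [p|//] def_w; case: y def_w => [q|//] def_w.
move=> /= /eqP cp /eqP cq.
have [k [k_next k_jump]] := alexander_numbering (erefl : size S = 2%N) dS sphS.
pose i := size u; pose j := (i + (size v).+1)%N.
have wi : onth w i = Some (inl p) by rewrite def_w onth_cat ltnn subnn.
have wj : onth w j = Some (inl q).
  rewrite def_w onth_cat ltnNge leq_addr /= addKn /=.
  by rewrite onth_cat ltnn subnn.
have [pw qw] : p \in passages w /\ q \in passages w.
  by rewrite !mem_passages; split; apply/onthP; [exists i | exists j].
have vi := visit_onth wi; have vj := visit_onth wj.
have lt_ij : (i < j)%N by rewrite -addn1 leq_add2l.
have def_q : q = other_passage p.
  have eq_l : label p = label q by rewrite cp cq.
  have [def_q|//] := gauss_word_same_label gw pw qw eq_l.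
  rewrite def_q in vj; have [eq_ij] := visit_inj dS vi vj.
  by rewrite eq_ij ltnn in lt_ij.
have other : other_position S (0%N, i) = (0%N, j).
  apply: visit_inj dS (visit_other_position dS vi) _; rewrite vj def_q.
  by case: (p) => [[? []] []].
apply: (@intr_inj rat); rewrite rmorph_sum /= (big_nth (inl p)).
rewrite -[RHS](loop_level_sum dS k_next k_jump lt_ij vi other).
have -> : j = (size v + i.+1)%N by rewrite addnS addnC -addnS.
rewrite -[in RHS](add0n i.+1) big_addn addnK; apply: eq_big_nat => n lt_n.
rewrite (letter_signE (z := nth (inl p) v n)) // def_w onth_cat.
rewrite ltnNge addnS leqW ?leq_addl //= subSn ?leq_addl // addnK /= onth_cat.
by case/andP: lt_n => _ lt_n; rewrite lt_n onthE (nth_map (inl p)).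
Qed.

End Balance.

(** * The index as a function of the Gauss word *)

Definition has_label (c : nat) (p : passage) : bool := label p == c.

(** The boolean records whether the reader is on the loop at [c] and flips at each passage through
    [c]. The scan thus splits over concatenations, and moves can be treated block by block. *)
Fixpoint scan_index (c : nat) (inside : bool) (w : seq passage) : int :=
  if w is p :: w' then
    if has_label c p then scan_index c (~~ inside) w'
    else (if inside then psign p else 0) + scan_index c inside w'
  else 0.

Definition gauss_index (w : seq passage) (c : nat) : int := scan_index c false w.

Lemma scan_index_cat c b u v : scan_index c b (u ++ v) =
  scan_index c b u + scan_index c (b (+) odd (count (has_label c) u)) v.
Proof.
elim: u b => [|p u IHu] b /=; first by rewrite addbF add0r.
by case: (has_label c p); rewrite /= IHu ?addrA // addbN addNb.
Qed.

Lemma scan_index_notin c b u : ~~ has (has_label c) u ->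
  scan_index c b u = if b then \sum_(p <- u) psign p else 0.
Proof.
elim: u => [|p u IHu] /=; first by rewrite big_nil; case: b.
rewrite negb_or big_cons => /andP[/negbTE-> /IHu->].
by case: (b); rewrite ?addr0.
Qed.

Lemma passages_cat u v : passages (u ++ v) = passages u ++ passages v.
Proof. exact: pmap_cat. Qed.

Lemma has_passages c w : has (has_label c) (passages w) = has (is_crossing c) w.
Proof. by elim: w => //= -[p|h] w /= ->. Qed.

Lemma count_passages c w :
  count (has_label c) (passages w) = count (is_crossing c) w.
Proof. by elim: w => //= -[p|h] w /= ->. Qed.

Lemma sum_letter_sign v : \sum_(z <- v) letter_sign z =
  \sum_(p <- passages v) psign p - \sum_(h <- hits v) hit_sign h.
Proof.
elim: v => [|[p|h] v IHv]; rewrite ?big_nil ?subrr //= !big_cons IHv /=.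
  by rewrite addrA.
by rewrite opprD addrCA.
Qed.

Lemma mem_crossings K c :
  reflect (exists2 p, p \in word_of K & label p = c) (c \in crossings K).
Proof.
by rewrite mem_undup; apply: (iffP mapP) => -[p pw eq_c]; exists p.
Qed.

Lemma word_of_gauss K : gauss_word (word_of K).
Proof. by case/andP: (word_ofP K). Qed.

(** The first part is [loop_balance]. By the second, the loop is a contiguous part of the letters,
    so its hits are among those of the whole diagram. *)
Lemma shortcut_indexE D c : c \in crossings (diagram_of D) ->
  shortcut_index D c = gauss_index (word_of (diagram_of D)) c /\
  exists u t, letters_of D = u ++ loop c (letters_of D) ++ t.
Proof.
case: D => K w a /= sc; have /and4P[/eqP def_K uh pa sphS] := sc.
have gw : gauss_word (passages w) by rewrite def_K word_of_gauss.
case/mem_crossings => p; rewrite -def_K => pw eq_c.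
have := gauss_word_count gw pw; rewrite eq_c -/(has_label c) count_passages.
case/count2_split => u [x [v [y [t [def_w cx cy [cu cv ct]]]]]].
have loop_w : loop c w = v by rewrite def_w loop_cat.
split; last first.
  by exists (rcons u x), (y :: t); rewrite loop_w def_w cat_rcons.
have /eqP := loop_balance gw uh pa sphS def_w cx cy.
rewrite sum_letter_sign subr_eq0 /shortcut_index /= loop_w => /eqP <-.
rewrite /gauss_index def_w passages_cat scan_index_cat.
rewrite scan_index_notin ?has_passages // add0r count_passages.
rewrite (_ : count _ u = 0%N) /=; last by apply/eqP; rewrite -leqn0 leqNgt -has_count.
case: x cx {def_w} => //= x' cx; rewrite /has_label cx /= passages_cat scan_index_cat.
rewrite scan_index_notin ?has_passages // count_passages.
rewrite (_ : count _ v = 0%N) /=; last by apply/eqP; rewrite -leqn0 leqNgt -has_count.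
case: y cy => //= y' cy; rewrite /has_label cy /=.
by rewrite scan_index_notin ?has_passages // addr0.
Qed.

Lemma index_gauss D c : c \in crossings (diagram_of D) ->
  Defs.index (diagram_of D) c = gauss_index (word_of (diagram_of D)) c.
Proof.
move=> cD; rewrite /Defs.index; case: pselect => [exD|]; last by case; exists D.
case: (cid exD) => /= D' eq_D; rewrite -eq_D in cD *.
by case: (shortcut_indexE cD).
Qed.

(** * Invariance of the n-writhes *)

(** Twice the n-writhe, each crossing being counted at its over-passage. *)
Definition gauss_writhe (n : int) (w : seq passage) : int :=
  \sum_(p <- w | is_over p && (gauss_index w (label p) == n))
     bsign (is_positive p).

Lemma scan_index_skip c b u v : ~~ has (has_label c) u ->
  scan_index c b (u ++ v) =
    (if b then \sum_(p <- u) psign p else 0) + scan_index c b v.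
Proof.
move=> cu; rewrite scan_index_cat scan_index_notin //.
by move: cu; rewrite has_count -eqn0Ngt => /eqP->; rewrite addbF.
Qed.

Lemma scan_index_insert c b u s v : ~~ has (has_label c) s ->
  \sum_(p <- s) psign p = 0 -> scan_index c b (u ++ s ++ v) = scan_index c b (u ++ v).
Proof.
move=> cs s0; rewrite !scan_index_cat [scan_index _ _ s]scan_index_notin // s0.
move: cs; rewrite has_count -eqn0Ngt => /eqP->; rewrite addbF.
by case: (b (+) _); rewrite add0r.
Qed.

Lemma psign_other c o s : psign (c, ~~ o, s) = - psign (c, o, s).
Proof. by case: o s => [] []. Qed.

Lemma psign_switch c d o s : psign (d, o, ~~ s) = - psign (c, o, s).
Proof. by case: o s => [] []. Qed.

Lemma perm_gauss_writhe n w w' : perm_eq w w' ->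
  {in w, forall p, gauss_index w (label p) = gauss_index w' (label p)} ->
  gauss_writhe n w = gauss_writhe n w'.
Proof.
move=> eq_w eq_i; rewrite /gauss_writhe -[RHS](perm_big _ eq_w) /=.
by rewrite [LHS]big_seq_cond [RHS]big_seq_cond; apply: eq_bigl => p;
  case wp: (p \in w); rewrite //= eq_i.
Qed.

Lemma gauss_writhe_insert n w w' s : perm_eq w' (s ++ w) ->
  {in w, forall p, gauss_index w' (label p) = gauss_index w (label p)} ->
  \sum_(p <- s | is_over p && (gauss_index w' (label p) == n))
     bsign (is_positive p) = 0 ->
  gauss_writhe n w' = gauss_writhe n w.
Proof.
move=> eq_w' eq_i s0; rewrite /gauss_writhe (perm_big _ eq_w') big_cat /= s0 add0r.
by rewrite [LHS]big_seq_cond [RHS]big_seq_cond; apply: eq_bigl => p;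
  case wp: (p \in w); rewrite //= eq_i.
Qed.

(** Being closed under [other_passage], [s] holds both passages of each of its crossings. *)
Lemma gauss_word_fresh w s r p q : gauss_word w -> perm_eq w (s ++ r) ->
  {in s, forall p, other_passage p \in s} -> p \in s -> q \in r ->
  label q != label p.
Proof.
move=> gw eq_w oth ps qr; have memw t : (t \in w) = (t \in s) || (t \in r).
  by rewrite (perm_mem eq_w) mem_cat.
have := gauss_word_uniq gw; rewrite (perm_uniq eq_w) cat_uniq.
case/and3P => _ /hasPn/(_ q qr) qs _; apply: contra qs => /eqP/esym eq_l.
have [||->|->] := gauss_word_same_label gw _ _ eq_l; rewrite ?memw ?ps ?qr ?orbT //.
exact: oth.
Qed.

Lemma has_labelPn c w :
  reflect {in w, forall p, label p != c} (~~ has (has_label c) w).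
Proof. exact: hasPn. Qed.

Lemma gauss_index_map f w c : injective f ->
  gauss_index [seq (f (label p), is_over p, is_positive p) | p <- w] (f c) =
  gauss_index w c.
Proof.
move=> f_inj; rewrite /gauss_index.
elim: w false => //= p w IHw b; rewrite /has_label /= !IHw.
by rewrite {1}/label /= (inj_eq f_inj).
Qed.

Lemma gauss_writhe_map n f w : injective f ->
  gauss_writhe n [seq (f (label p), is_over p, is_positive p) | p <- w] =
  gauss_writhe n w.
Proof.
move=> f_inj; rewrite /gauss_writhe big_map; apply: eq_bigl => p.
by rewrite gauss_index_map.
Qed.

(** * Effect of each Reidemeister move on Gauss words *)

Lemma gauss_writhe_RI n u v c o s : n != 0 ->
  gauss_word (u ++ [:: (c, o, s); (c, ~~ o, s)] ++ v) ->
  gauss_writhe n (u ++ [:: (c, o, s); (c, ~~ o, s)] ++ v) =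
  gauss_writhe n (u ++ v).
Proof.
set t := [:: _; _] => n0 gw.
have eq_w : perm_eq (u ++ t ++ v) (t ++ u ++ v) by rewrite perm_catCA.
have oth : {in t, forall p, other_passage p \in t}.
  by move=> p; rewrite !inE => /orP[]/eqP->;
    rewrite /other_passage /= ?negbK eqxx ?orbT.
have fresh p : p \in u ++ v -> label p != c.
  move=> puv; have := gauss_word_fresh gw eq_w oth (mem_head _ _) puv.
  exact.
have t0 : \sum_(p <- t) psign p = 0.
  by rewrite !big_cons big_nil psign_other addr0 subrr.
apply: (gauss_writhe_insert eq_w) => [p puv|].
  apply: scan_index_insert t0; rewrite /= /has_label /= orbF orbb.
  by rewrite eq_sym fresh.
have [cu cv] : ~~ has (has_label c) u /\ ~~ has (has_label c) v.
  by split; apply/has_labelPn => p pu; apply: fresh; rewrite mem_cat pu ?orbT.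
rewrite big_seq_cond big_pred0 // => p; apply/negP => /and3P[pt _].
have -> : label p = c by move: pt; rewrite !inE => /orP[]/eqP->.
(* The loop at the new crossing is empty, so its index is 0, which differs from [n]. *)
rewrite /gauss_index scan_index_skip // /= /has_label /= eqxx.
by rewrite scan_index_notin // addr0 eq_sym (negbTE n0).
Qed.

(** The new crossings have opposite signs and equal indices. In the direct case the loops at [c] and
    [d] consist of [v] and one passage each, of equal [psign]; in the opposite case the loop at [c]
    consists of [v] and both passages of [d], which cancel. *)
Lemma gauss_writhe_RII n u v w c d o s (direct : bool) :
  let t := [:: (c, o, s); (d, o, ~~ s)] in
  let t' := [:: (c, ~~ o, s); (d, ~~ o, ~~ s)] in
  let w' := u ++ t ++ v ++ (if direct then t' else rev t') ++ w in
  gauss_word w' -> gauss_writhe n w' = gauss_writhe n (u ++ v ++ w).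
Proof.
move=> t t'; set t'' := (if direct then _ else _); move=> w' gw.
have eq_t'' : perm_eq t'' t' by rewrite /t''; case: (direct); rewrite // perm_rev.
have eq_w : perm_eq w' ((t ++ t') ++ u ++ v ++ w).
  by apply/permP => P; rewrite /w' !count_cat (permP eq_t''); lia.
have oth : {in t ++ t', forall p, other_passage p \in t ++ t'}.
  move=> p; rewrite !inE => /or4P[]/eqP->; rewrite /other_passage /= ?negbK eqxx;
  by rewrite ?orbT.
have fresh p q : p \in u ++ v ++ w -> q \in t ++ t' -> label p != label q.
  by move=> puv qt; apply: gauss_word_fresh gw eq_w oth qt puv.
have neq_cd : c != d.
  apply/eqP => eq_cd; have /andP[+ _] := gw.
  rewrite (perm_uniq (perm_map _ eq_w)) /= eq_cd inE.
  by rewrite [X in _ == X](_ : _ = (d, o)) // eqxx.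
have t0 : \sum_(p <- t) psign p = 0.
  by rewrite !big_cons big_nil (psign_switch c) addr0 subrr.
have t''0 : \sum_(p <- t'') psign p = 0.
  rewrite (perm_big _ eq_t'') !big_cons big_nil (psign_switch c).
  by rewrite /= addr0 subrr.
apply: (gauss_writhe_insert eq_w) => [p puv|].
  have tp q : q \in t ++ t' -> label q != label p.
    by move=> qt; rewrite eq_sym fresh.
  have tt' q : q \in t'' -> q \in t ++ t'.
    by rewrite (perm_mem eq_t'') mem_cat orbC => ->.
  rewrite /gauss_index /w' scan_index_insert //; last first.
    by apply/has_labelPn => q qt; apply: tp; rewrite mem_cat qt.
  rewrite [in LHS](catA u v) (@scan_index_insert _ _ (u ++ v)) -?catA //.
  by apply/has_labelPn => q /tt'; apply: tp.
have notin x : x \in [:: c; d] ->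
   [/\ ~~ has (has_label x) u, ~~ has (has_label x) v & ~~ has (has_label x) w].
  move=> xcd; have [q qt <-] : exists2 q, q \in t ++ t' & label q = x.
    by move: xcd; rewrite !inE => /orP[]/eqP->;
      [exists (c, o, s) | exists (d, o, ~~ s)]; rewrite ?inE ?eqxx ?orbT.
  by split; apply/has_labelPn => p pu; apply: fresh => //; rewrite !mem_cat pu ?orbT.
have [cu cv cw] : [/\ ~~ has (has_label c) u, ~~ has (has_label c) v
  & ~~ has (has_label c) w] by apply: notin; rewrite inE eqxx.
have [du dv dw] : [/\ ~~ has (has_label d) u, ~~ has (has_label d) v
  & ~~ has (has_label d) w] by apply: notin; rewrite !inE eqxx orbT.
have eq_cd : gauss_index w' c = gauss_index w' d.
  have neq_dc : (d == c) = false by rewrite eq_sym (negbTE neq_cd).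
  have hE x y e f : has_label x (y, e, f) = (y == x) by [].
  have cE := (hE, eqxx, neq_dc, negbTE neq_cd).
  rewrite /gauss_index /w' (scan_index_skip _ _ cu) (scan_index_skip _ _ du) /=.
  rewrite !cE /= (scan_index_skip _ _ cv) (scan_index_skip _ _ dv) !add0r.
  rewrite /t''; case: (direct); rewrite /= !cE /= !scan_index_notin // !addr0.
    by rewrite psign_other (psign_switch c) ?add0r addrC.
  by rewrite psign_other ?add0r addrCA subrr addr0.
rewrite !big_cons big_nil /= eq_cd.
by case: (_ == n);
  case: o s {t t' t'' w' gw eq_t'' eq_w oth fresh notin t0 t''0 eq_cd} => [] [].
Qed.

(** Reversing a block with an odd number of passages through [c] changes the scan by [e] if it
    enters the block on the loop, and by [- e] if it enters off the loop. *)
Definition swap_defect (c : nat) (e : int) (B : seq passage) : Prop :=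
  forall b, scan_index c b (rev B) =
    scan_index c b B + (if odd (count (has_label c) B) then bsign b * e else 0).

Lemma swap_defect_notin c e B : ~~ has (has_label c) B -> swap_defect c e B.
Proof.
move=> cB b; rewrite !scan_index_notin ?has_rev //.
move: cB; rewrite has_count -eqn0Ngt => /eqP->; rewrite addr0.
by case: b => //; apply/perm_big; rewrite perm_rev.
Qed.

Lemma swap_defect_pair c e (d : bool) p q : label p = c -> label q != c ->
  e = bsign d * psign q -> swap_defect c e (if d then [:: p; q] else [:: q; p]).
Proof.
move=> /eqP cp /negbTE cq -> b.
by case: d b => [] []; rewrite /= /has_label cp cq /= /bsign; lia.
Qed.

(* The loop at [c] starts in one block and ends in another one, so that the two *)
(* changes have opposite signs.                                                 *)
Lemma gauss_index_swap c e u0 b1 u1 b2 u2 b3 u3 :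
  {in [:: b1; b2; b3], forall B, swap_defect c e B} ->
  (forall v, v \in [:: u0; u1; u2; u3] -> ~~ has (has_label c) v) ->
  ~~ odd (count (has_label c) (flatten [:: b1; b2; b3])) ->
  gauss_index (u0 ++ rev b1 ++ u1 ++ rev b2 ++ u2 ++ rev b3 ++ u3) c =
  gauss_index (u0 ++ b1 ++ u1 ++ b2 ++ u2 ++ b3 ++ u3) c.
Proof.
move=> defect cu even_c; rewrite /gauss_index.
have odd0 v : v \in [:: u0; u1; u2; u3] -> odd (count (has_label c) v) = false.
  by move/cu; rewrite has_count -eqn0Ngt => /eqP->.
have [d1 d2 d3] : [/\ swap_defect c e b1, swap_defect c e b2 & swap_defect c e b3].
  by split; apply: defect; rewrite !inE eqxx ?orbT.
rewrite !scan_index_cat !count_rev d1 d2 d3 (odd0 u0) ?(odd0 u1) ?(odd0 u2)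
  ?inE ?eqxx ?orbT //.
rewrite !addbF /=; move: even_c; rewrite /= cats0 !count_cat !oddD.
case: (odd (count _ b1)) (odd (count _ b2)) (odd (count _ b3)) => [] [] [] //= _;
  by rewrite /bsign; lia.
Qed.

Lemma gauss_index_swap0 c u0 b1 u1 b2 u2 b3 u3 :
  {in [:: b1; b2; b3], forall B, ~~ has (has_label c) B} ->
  gauss_index (u0 ++ rev b1 ++ u1 ++ rev b2 ++ u2 ++ rev b3 ++ u3) c =
  gauss_index (u0 ++ b1 ++ u1 ++ b2 ++ u2 ++ b3 ++ u3) c.
Proof.
move=> cB; have D B b : B \in [:: b1; b2; b3] ->
    scan_index c b (rev B) = scan_index c b B.
  by move=> /cB/(@swap_defect_notin c 0 B) ->; rewrite mulr0 if_same addr0.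
by rewrite /gauss_index !scan_index_cat !count_rev !D ?inE ?eqxx ?orbT.
Qed.

Lemma perm_blocks (T : eqType) (u0 b1 u1 b2 u2 b3 u3 : seq T) :
  perm_eq (u0 ++ b1 ++ u1 ++ b2 ++ u2 ++ b3 ++ u3)
          (flatten [:: b1; b2; b3] ++ u0 ++ u1 ++ u2 ++ u3).
Proof. by apply/permP => P; rewrite /= cats0 !count_cat; lia. Qed.

(** All indices are preserved. A crossing of the triangle lies on two of the blocks. Its defect [e]
    is the sign with which a traveller leaving it along a side of the triangle crosses the third
    strand; both sides start on the same side of that strand, so the two blocks share [e] and their
    defects cancel in [gauss_index_swap]. *)
Lemma gauss_writhe_RIII n u0 u1 u2 u3 b1 b2 b3 x y z (ccw dt dm db : bool) :
  let sx := ~~ (ccw (+) dt (+) dm) in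
  let sy := ccw (+) dt (+) db in
  let sz := ~~ (ccw (+) dm (+) db) in
  let directed (d : bool) (p q : passage) :=
    if d then [:: p; q] else [:: q; p] in
  let top := directed dt (x, true, sx) (y, true, sy) in
  let middle := directed dm (z, true, sz) (x, false, sx) in
  let bottom := directed db (y, false, sy) (z, false, sz) in
  perm_eq [:: b1; b2; b3] [:: top; middle; bottom] ->
  let w := u0 ++ b1 ++ u1 ++ b2 ++ u2 ++ b3 ++ u3 in
  gauss_word w ->
  gauss_writhe n w =
  gauss_writhe n (u0 ++ rev b1 ++ u1 ++ rev b2 ++ u2 ++ rev b3 ++ u3).
Proof.
move=> sx sy sz directed top middle bottom perm_b w gw.
pose B := flatten [:: top; middle; bottom].
pose s := [:: (x, true, sx); (y, true, sy); (z, true, sz);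
              (x, false, sx); (y, false, sy); (z, false, sz)].
have perm_dir d p q : perm_eq (directed d p q) [:: p; q].
  by case: d => //; rewrite -[[:: p; q]]/(rev [:: q; p]) perm_sym perm_rev.
have perm_B : perm_eq B s.
  exact: perm_cat (perm_dir _ _ _) (perm_cat (perm_dir _ _ _)
    (perm_cat (perm_dir _ _ _) (perm_refl [::]))).
have perm_bB : perm_eq (flatten [:: b1; b2; b3]) s.
  by apply: perm_trans perm_B; apply: perm_flatten.
pose r := u0 ++ u1 ++ u2 ++ u3.
have eq_w : perm_eq w (s ++ r).
  by apply: perm_trans (perm_blocks _ _ _ _ _ _ _) _; rewrite perm_cat2r.
have oth : {in s, forall p, other_passage p \in s}.
  by move=> p; rewrite !inE => /orP[/eqP->|/or4P[/eqP->|/eqP->|/eqP->|/orP[]/eqP->]];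
    rewrite /other_passage /= eqxx ?orbT.
have fresh p q : p \in s -> q \in r -> label q != label p.
  exact: gauss_word_fresh gw eq_w oth.
have [neq_xy neq_xz neq_yz] : [/\ x != y, x != z & y != z].
  have /andP[] := gw; rewrite (perm_uniq (perm_map _ eq_w)) map_cat cat_uniq.
  rewrite /= !inE /label /is_over /= !xpair_eqE /= !andbT !andbF !orbF.
  by case/andP=> /andP[]; rewrite negb_or => /andP[-> ->] /andP[-> _].
apply: perm_gauss_writhe => [|p].
  by apply/permP => P; rewrite /w !count_cat !count_rev.
rewrite (perm_mem eq_w) mem_cat => /orP[ps|pr]; apply/esym; last first.
  apply: gauss_index_swap0 => b bB; apply/has_labelPn => q qb.
  rewrite eq_sym; apply: fresh pr; rewrite -(perm_mem perm_bB).
  by apply/flattenP; exists b.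
have u_fresh v : v \in [:: u0; u1; u2; u3] -> ~~ has (has_label (label p)) v.
  move=> vu; apply/has_labelPn => q qv; apply: fresh => //.
  by move: vu qv; rewrite /r !mem_cat !inE => /or4P[]/eqP-> ->; rewrite ?orbT.
have even_p : ~~ odd (count (has_label (label p)) (flatten [:: b1; b2; b3])).
  have pw : p \in w by rewrite (perm_mem eq_w) mem_cat ps.
  have : ~~ has (has_label (label p)) r.
    by apply/has_labelPn => q qr; apply: fresh.
  rewrite has_count -eqn0Ngt => /eqP count_r.
  have : count (has_label (label p)) w = 2%N := gauss_word_count gw pw.
  by rewrite (permP eq_w) count_cat -(permP perm_bB) count_r addn0 => ->.
suff [e defect] : exists e, {in [:: top; middle; bottom], forall b,
    swap_defect (label p) e b}.
  apply: gauss_index_swap u_fresh even_p => b bB.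
  by apply: defect; rewrite -(perm_mem perm_b).
have : label p \in [:: x; y; z].
  by move: ps; rewrite !inE => /orP[/eqP->|/or4P[/eqP->|/eqP->|/eqP->|/orP[]/eqP->]];
    rewrite eqxx ?orbT.
(* Used to list first the passage through the crossing under study, as [swap_defect_pair]
   requires. *)
have swapE d q q' : directed d q q' = directed (~~ d) q' q by case: d.
have neqs := (neq_xy, neq_xz, neq_yz, eq_sym y x, eq_sym z x, eq_sym z y).
have notin c d q q' : label q != c -> label q' != c ->
    ~~ has (has_label c) (directed d q q').
  by move=> /negbTE cq /negbTE cq'; case: d; rewrite /= /has_label cq cq'.
rewrite !inE => /or3P[]/eqP->.
- exists (bsign dt * psign (y, true, sy)) => b; rewrite !inE => /or3P[]/eqP->.
  + by apply: swap_defect_pair; rewrite //= neqs.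
  + rewrite /middle swapE; apply: swap_defect_pair; rewrite ?neqs //.
    by rewrite /sy /sz; case: (ccw) (dt) (dm) (db) => [] [] [] [].
  + by apply/swap_defect_notin/notin; rewrite neqs.
- exists (bsign (~~ dt) * psign (x, true, sx)) => b; rewrite !inE => /or3P[]/eqP->.
  + by rewrite /top swapE; apply: swap_defect_pair; rewrite ?neqs.
  + by apply/swap_defect_notin/notin; rewrite neqs.
  + apply: swap_defect_pair; rewrite ?neqs //.
    by rewrite /sx /sz; case: (ccw) (dt) (dm) (db) => [] [] [] [].
- exists (bsign dm * psign (x, false, sx)) => b; rewrite !inE => /or3P[]/eqP->.
  + by apply/swap_defect_notin/notin; rewrite neqs.
  + by apply: swap_defect_pair; rewrite ?neqs.
  + rewrite /bottom swapE; apply: swap_defect_pair; rewrite ?neqs //.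
    by rewrite /sx /sy; case: (ccw) (dt) (dm) (db) => [] [] [] [].
Qed.

(** * Signed heights *)

Lemma reidemeister_gauss_writhe n w w' : n != 0 -> gauss_word w ->
  gauss_word w' -> reidemeister_word w w' -> gauss_writhe n w = gauss_writhe n w'.
Proof.
move=> n0 gw gw' red; case: red gw gw' => {w w'}.
- by move=> w f f_inj _ _; rewrite gauss_writhe_map.
- by move=> u v c o s _ gw'; rewrite gauss_writhe_RI.
- by move=> u v w c d o s _ gw'; apply/esym/(@gauss_writhe_RII _ _ _ _ _ _ _ _ true).
- by move=> u v w c d o s _ gw'; apply/esym/(@gauss_writhe_RII _ _ _ _ _ _ _ _ false).
- move=> u0 u1 u2 u3 b1 b2 b3 x y z ccw dt dm db sx sy sz directed top middle bottom.
  by move=> perm_b gw _; apply: gauss_writhe_RIII perm_b gw.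
Qed.

Lemma knotoid_gauss_writhe n K K' : n != 0 -> \pi_knotoid%qT K = \pi_knotoid%qT K' ->
  gauss_writhe n (word_of K) = gauss_writhe n (word_of K').
Proof.
move=> n0 /eqquotP/asboolP; elim=> {K K'} [K K' red|K|K K' _ ->|K K' K'' _ -> _ ->] //.
exact: reidemeister_gauss_writhe (word_of_gauss _) (word_of_gauss _) red.
Qed.

Lemma perm_crossings K :
  perm_eq (crossings K) [seq label p | p <- word_of K & is_over p].
Proof.
have gK := word_of_gauss K; have /andP[_ /allP oth] := gK.
apply: uniq_perm => [||c]; first exact: undup_uniq.
  rewrite map_inj_in_uniq ?filter_uniq ?gauss_word_uniq // => p q.
  rewrite !mem_filter => /andP[op pw] /andP[oq qw] eq_l.
  have [//|def_q] := gauss_word_same_label gK pw qw eq_l.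
  by move: oq; rewrite def_q [is_over _]/(~~ is_over p) op.
apply/mem_crossings/mapP => [[p pw <-]|[p]]; last first.
  by rewrite mem_filter => /andP[_ pw] ->; exists p.
have [op|op] := boolP (is_over p); first by exists p; rewrite ?mem_filter ?op.
by exists (other_passage p); rewrite // mem_filter oth ?andbT.
Qed.

Lemma crossing_sum n D (K := diagram_of D) :
  \sum_(c <- crossings K | Defs.index K c == n) crossing_sign K c =
  gauss_writhe n (word_of K).
Proof.
have gK := word_of_gauss K.
transitivity (\sum_(c <- crossings K | gauss_index (word_of K) c == n)
    crossing_sign K c).
  rewrite big_seq_cond [RHS]big_seq_cond; apply: eq_bigl => c.
  by case cK: (c \in crossings K); rewrite //= index_gauss.
rewrite (perm_big _ (perm_crossings K)) big_map big_filter_cond.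
rewrite /gauss_writhe big_seq_cond [RHS]big_seq_cond.
apply: eq_bigr => p /and3P[pw op _]; rewrite /crossing_sign /bsign.
case: ifP => [tw|]; last first.
  by case: p pw op => [[c []] []] //= -> .
have [//|def_p|] := gauss_word_same_label gK pw tw _; first by rewrite -def_p.
by case: (p) op => [[d []] t] //= _ [].
Qed.

Lemma writhe_neq0 K n : n != 0 -> writhe K n != 0 ->
  (exists D, diagram_of D = K) /\ gauss_writhe n (word_of K) != 0.
Proof.
move=> n0; rewrite /writhe => wn0.
have exD : exists D, diagram_of D = K.
  (* Without a shortcut diagram, every index takes the default value 0, and the sum at a nonzero [n]
     is empty. *)
  apply: contra_notP (negP wn0) => noD; rewrite big_pred0 ?div0z // => c.
  by rewrite /Defs.index; case: pselect => // _; rewrite eq_sym (negbTE n0).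
split=> //; case: exD wn0 => D <-; rewrite crossing_sum.
by apply: contraNneq => ->; rewrite div0z.
Qed.

(** Away from exponent 0, only the summand of index [n] can contribute to the coefficient at [n]. *)
Lemma msupp_diagram_index_poly K n : n \in msupp (diagram_index_poly K) ->
  n != 0 -> writhe K n != 0.
Proof.
rewrite -mcoeff_neq0 => pn0 n0; apply: contraNneq pn0 => wn0.
rewrite /diagram_index_poly raddf_sum big1 // => m m0 /=.
have [->|neq_mn] := eqVneq m n; first by rewrite wn0 mulr0z mcoeff0.
rewrite raddfMz /= mcoeffB !mcoeffU (negbTE neq_mn) eq_sym (negbTE n0).
by rewrite subrr mul0rz.
Qed.

Lemma sum_hit_sign_le s : \sum_(h <- s) hit_sign h <= (count snd s)%:Z /\
  - \sum_(h <- s) hit_sign h <= (count (fun h : hit => ~~ h.2) s)%:Z.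
Proof.
elim: s => [|[x b] s [IHp IHm]]; first by rewrite big_nil.
rewrite big_cons; move: (\sum_(h <- s) hit_sign h) IHp IHm => t IHp IHm.
by rewrite /hit_sign; case: b => /=; lia.
Qed.

Lemma shortcut_index_bound D c : c \in crossings (diagram_of D) ->
  shortcut_index D c <= (diagram_h_plus D)%:Z /\
  - shortcut_index D c <= (diagram_h_minus D)%:Z.
Proof.
case/shortcut_indexE => _ [u [t]].
have := sum_hit_sign_le (hits (loop c (letters_of D))).
rewrite -/(shortcut_index D c); move: (loop _ _) => v [lep lem] def_w.
have count_v P : (count P (hits v))%:Z <= (count P (hits (letters_of D)))%:Z.
  by rewrite lez_nat def_w /hits !pmap_cat !count_cat addnCA leq_addr.
by split; [apply: le_trans lep (count_v _) | apply: le_trans lem (count_v _)].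
Qed.

(** Invariance carries the nonzero n-writhe from the chosen representative to any [D], which
    therefore has a crossing of index [n]. The existence part makes the heights minima over nonempty
    sets, as [le_nat_min] requires. *)
Lemma index_poly_supp k n : n \in msupp (index_poly k) -> n != 0 ->
  (exists D, represents (diagram_of D) k) /\
  forall D, represents (diagram_of D) k ->
    n <= (diagram_h_plus D)%:Z /\ - n <= (diagram_h_minus D)%:Z.
Proof.
move=> /msupp_diagram_index_poly wn n0.
have [[D0 def_D0] gn0] := writhe_neq0 n0 (wn n0).
split; first by exists D0; rewrite /represents def_D0 reprK.
move=> D repD; have eq_pi : \pi_knotoid%qT (repr k) = \pi_knotoid%qT (diagram_of D).
  by rewrite reprK.
move: gn0; rewrite (knotoid_gauss_writhe n0 eq_pi) => gn0.
have /hasP[p pw /andP[_ /eqP def_n]] : has (fun p => is_over p &&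
    (gauss_index (word_of (diagram_of D)) (label p) == n)) (word_of (diagram_of D)).
  by apply: contraNT gn0 => /hasPn noP; rewrite /gauss_writhe big_hasC //; apply/hasPn.
have cD : label p \in crossings (diagram_of D) by apply/mem_crossings; exists p.
have := shortcut_index_bound cD; have [-> _] := shortcut_indexE cD.
by rewrite def_n.
Qed.

Lemma le_nat_min (P : nat -> Prop) (d : int) : (exists m, P m) ->
  (forall m, P m -> d <= m%:Z) -> d <= (nat_min P)%:Z.
Proof.
move=> [m Pm] leP; rewrite /nat_min; case: pselect => [exP|[]].
  by case: ex_minnP => i /asboolP Pi _; apply: leP.
by exists m; apply/asboolP.
Qed.

Theorem theorem1p5 (k : knotoid) :
  deg_plus (index_poly k) <= (h_plus k)%:Z /\
  deg_minus (index_poly k) <= (h_minus k)%:Z.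
Proof.
split; rewrite /deg_plus /deg_minus big_seq; apply: bigmax_le => // n kn.
  (* The exponent 0 satisfies the bound since heights are nonnegative. *)
  have [->//|n0] := eqVneq n 0; have [[D repD] bound] := index_poly_supp kn n0.
  apply: le_nat_min; first by exists (diagram_h_plus D), D.
  by move=> _ [D' [/bound[leD _] <-]].
have [->//|n0] := eqVneq n 0; have [[D repD] bound] := index_poly_supp kn n0.
apply: le_nat_min; first by exists (diagram_h_minus D), D.
by move=> _ [D' [/bound[_ leD] <-]].
Qed.
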